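(* Let $X$ be a nonempty finite metric space and let $\lambda>0$ be a real number with $\lambda\ge 2\operatorname{diam}X$. Then $$ \operatorname{mst}(X)=\sum_{k=1}^\infty\bigl[\lambda-2\,d_{GH}(X,\lambda\Delta_{k+1})\bigr]=\lambda(\#X-1)-2\sum_{k=1}^{\#X-1}d_{GH}(X,\lambda\Delta_{k+1}). $$
   Context: For a metric space, $|xy|$ denotes the distance between points $x$ and $y$, and $\#X$ is the cardinality of $X$. $d_{GH}$ denotes the Gromov--Hausdorff distance: $d_{GH}(X,Y)$ is the infimum of real numbers $r$ such that there exist a metric space $Z$ and subsets $X',Y'\subset Z$ isometric to $X$ and $Y$ respectively with Hausdorff distance $d_H(X',Y')\le r$. For $\lambda>0$, $\lambda\Delta_m$ denotes the metric space on $\{1,\ldots,m\}$ all of whose nonzero distances equal $\lambda$. $\operatorname{mst}(X)$ is the length of a minimum spanning tree on the finite metric space $X$: the smallest length of a tree $G=(X,E)$ with vertex set exactly $X$, where the length of a tree is the sum over its edges $vw$ of the distances $|vw|$. *)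

(* Defs.v *)
From HB Require Import structures.
From mathcomp Require Import all_boot all_order all_algebra.
From mathcomp Require Import all_classical all_reals all_analysis.

Set Implicit Arguments.
Unset Strict Implicit.
Unset Printing Implicit Defensive.

Import Order.TTheory GRing.Theory Num.Theory.
Import numFieldNormedType.Exports.

Local Open Scope classical_set_scope.
Local Open Scope ring_scope.

#[short(type="finMetricType")]
HB.structure Definition FinMetric (R : numDomainType) :=
  { T of Finite T & Metric R T }.

Definition diam (R : realType) (X : metricType R) : \bar R :=
  ereal_sup [set (mdist p.1 p.2)%:E | p in [set: X * X]].

(* The infimum over r > 0 such that each of A and B lies in the open
   r-neighbourhood of the other; it is +oo when there is no such r. *)
Definition hausdorff_dist (R : realType) (Z : metricType R) (A B : set Z) :
    \bar R :=
  ereal_inf [set r%:E | r in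
    [set r : R | [/\ 0 < r, A `<=` \bigcup_(b in B) ball b r
                          & B `<=` \bigcup_(a in A) ball a r]]].

Definition isometric_to_subset (R : realType) (X Z : metricType R)
    (A : set Z) : Prop :=
  exists2 f : X -> Z, (forall x y, mdist (f x) (f y) = mdist x y) & range f = A.

Definition gh_dist (R : realType) (X Y : metricType R) : \bar R :=
  ereal_inf [set r%:E | r in
    [set r : R | exists (Z : metricType R) (X' Y' : set Z),
      [/\ isometric_to_subset X X', isometric_to_subset Y Y'
        & (hausdorff_dist X' Y' <= r%:E)%E]]].

(* The proof of 0 < lam is a parameter because the axioms of a metric space
   depend on it. *)
Definition simplex (R : realType) (lam : R) (lam_gt0 : 0 < lam) (m : nat) :
  Type := 'I_m.

Section simplex_metric.
Variables (R : realType) (lam : R) (lam_gt0 : 0 < lam) (m : nat).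
Local Notation T := (simplex lam_gt0 m).

HB.instance Definition _ := Finite.copy T 'I_m.

Definition simplex_dist (x y : T) : R := if x == y then 0 else lam.

Lemma simplex_distxx x : simplex_dist x x = 0.
Proof. by rewrite /simplex_dist eqxx. Qed.

Lemma simplex_dist_eq0 x y : simplex_dist x y = 0 -> x = y.
Proof.
rewrite /simplex_dist; case: eqP => // _ /eqP lam0.
by have := lt0r_neq0 lam_gt0; case/negP.
Qed.

Lemma simplex_distC x y : simplex_dist x y = simplex_dist y x.
Proof. by rewrite /simplex_dist eq_sym. Qed.

Lemma simplex_dist_triangle y x z :
  simplex_dist x z <= simplex_dist x y + simplex_dist y z.
Proof.
rewrite /simplex_dist; have lam_ge0 := ltW lam_gt0.
have [->|_] := eqVneq x y; first by rewrite add0r.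
by case: ifP => _; case: ifP => _; rewrite ?addr0 ?lerDl// addr_ge0.
Qed.

HB.instance Definition _ := @isMetric.Build R T simplex_dist
  simplex_distxx simplex_dist_eq0 simplex_distC simplex_dist_triangle.

End simplex_metric.

(* A graph is given by its adjacency relation.  Acyclicity excludes cycles
   through at least three distinct vertices: for a symmetric relation,
   ucycle e [:: x; y] holds for every edge xy. *)
Definition is_tree (X : finType) (e : rel X) : Prop :=
  [/\ symmetric e, irreflexive e, (forall x y, connect e x y)
    & forall p : seq X, ucycle e p -> (size p <= 2)%N].

(* The sum runs over ordered pairs, so each edge occurs twice in it. *)
Definition tree_length (R : realType) (X : finMetricType R) (e : rel X) : R :=
  (\sum_(x : X) \sum_(y : X | e x y) mdist x y) / 2.

(* There are finitely many graphs on X, so this infimum is a minimum as soon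
   as X is nonempty. *)
Definition mst (R : realType) (X : finMetricType R) : \bar R :=
  ereal_inf [set (tree_length e)%:E | e in [set e : rel X | is_tree e]].

(* Main.v *)
(* Run Kruskal's algorithm on X, with n = #|X|: step i joins two classes by a
   shortest edge, of length w_i, and leaves n - i - 1 classes.  Since
   lam >= 2 diam X, the distance from X to lam Delta_{k+1} is governed by
   partitions of X into k + 1 classes: 2 d_GH = lam - alpha, where alpha is the
   largest possible minimal distance between distinct classes.  The Kruskal
   partition shows alpha >= w_{n-k-1}.  Conversely, the first n - k Kruskal
   edges leave only k classes, so one of them crosses any partition into k + 1
   classes, whence alpha <= w_{n-k-1}.  For k >= n a pigeonhole argument gives
   2 d_GH = lam.  Summing over k, it remains to see that mst X is the sum of the
   w_i: the Kruskal edges form a tree of this length, and a connected graph has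
   at least n - 1 - j edges crossing the classes of step j, each of length at
   least w_j, so Abel summation bounds its length from below. *)
Require Import Defs.
From HB Require Import structures.
From mathcomp Require Import all_boot all_order all_algebra.
From mathcomp Require Import all_classical all_reals all_analysis.
From mathcomp Require Import lra.

Set Implicit Arguments.
Unset Strict Implicit.
Unset Printing Implicit Defensive.

Import Order.TTheory GRing.Theory Num.Theory.
Import numFieldNormedType.Exports.

Local Open Scope classical_set_scope.
Local Open Scope ring_scope.

(** * Gluing two metric spaces along a cross distance *)

(** The axioms are the positivity and triangle inequalities that mix the two spaces, so that their
    disjoint union becomes a metric space. *)
Record coupling (R : realType) (X Y : metricType R) := Coupling {
  cross :> X -> Y -> R;
  cross_gt0 : forall x y, 0 < cross x y;
  cross_lel : forall x x' y, cross x y <= mdist x x' + cross x' y;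
  cross_ler : forall x y y', cross x y <= cross x y' + mdist y' y;
  mdistl_le_cross : forall x x' y, mdist x x' <= cross x y + cross x' y;
  mdistr_le_cross : forall x y y', mdist y y' <= cross x y + cross x y'
}.

(** The alias carries [c], on which the metric instance below depends. *)
Definition glue (R : realType) (X Y : metricType R) (c : coupling X Y) : Type :=
  (X + Y)%type.

Section glue_metric.
Context {R : realType} {X Y : metricType R} (c : coupling X Y).

HB.instance Definition _ := Choice.copy (glue c) (X + Y)%type.

Definition glue_dist (u v : glue c) : R :=
  match u, v with
  | inl x, inl x' => mdist x x'
  | inr y, inr y' => mdist y y'
  | inl x, inr y | inr y, inl x => c x y
  end.

Lemma glue_distxx u : glue_dist u u = 0.
Proof. by case: u => z /=; rewrite mdistxx. Qed.

Lemma glue_dist_eq0 u v : glue_dist u v = 0 -> u = v.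
Proof.
case: u v => [x|y] [x'|y'] /=.
- by move=> /mdist_positivity ->.
- by have /[swap] -> := cross_gt0 c x y'; rewrite ltxx.
- by have /[swap] -> := cross_gt0 c x' y; rewrite ltxx.
- by move=> /mdist_positivity ->.
Qed.

Lemma glue_distC u v : glue_dist u v = glue_dist v u.
Proof. by case: u v => [x|y] [x'|y'] //=; rewrite metric_sym. Qed.

Lemma glue_dist_triangle v u w :
  glue_dist u w <= glue_dist u v + glue_dist v w.
Proof.
case: u v w => [x|y] [x'|y'] [x''|y''] /=.
- exact: metric_triangle.
- exact: cross_lel.
- exact: mdistl_le_cross.
- exact: cross_ler.
- by rewrite addrC [mdist x' _]metric_sym cross_lel.
- exact: mdistr_le_cross.
- by rewrite addrC [mdist y _]metric_sym cross_ler.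
- exact: metric_triangle.
Qed.

HB.instance Definition _ := @isMetric.Build R (glue c) glue_dist
  glue_distxx glue_dist_eq0 glue_distC glue_dist_triangle.

End glue_metric.

(** * Gromov-Hausdorff bounds from couplings and correspondences *)

Section gromov_hausdorff.
Context {R : realType} {X Y : metricType R}.

Lemma gh_dist_le_coupling (c : coupling X Y) (s : R) : 0 <= s ->
  (forall x, exists y, c x y <= s) -> (forall y, exists x, c x y <= s) ->
  (gh_dist X Y <= s%:E)%E.
Proof.
move=> s0 cX cY; apply: ereal_inf_lbound; exists s => //.
exists (glue c : metricType R).
exists (range (inl : X -> glue c)), (range (inr : Y -> glue c)).
split; [by exists inl|by exists inr|].
(* [hausdorff_dist] uses open balls of positive radius, so [s] is approached by the radii
   [s + e]. *)
apply/lee_addgt0Pr => e e0; apply: ereal_inf_lbound; exists (s + e) => //.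
split; first by rewrite ltr_wpDl.
- move=> _ [x _ <-]; have [y cxy] := cX x.
  exists (inr y); first by exists y.
  by rewrite ballEmdist; apply: le_lt_trans cxy _; rewrite ltrDl.
- move=> _ [y _ <-]; have [x cxy] := cY y.
  exists (inl x); first by exists x.
  by rewrite ballEmdist; apply: le_lt_trans cxy _; rewrite ltrDl.
Qed.

(** Points are related when their images in a common space are closer than some [t < s]; triangle
    inequalities keep the distortion below [2 * t]. *)
Lemma gh_dist_lt_correspondence (s : R) : (gh_dist X Y < s%:E)%E ->
  exists C : X -> Y -> Prop,
  [/\ forall x, exists y, C x y, forall y, exists x, C x y &
    forall x x' y y', C x y -> C x' y' ->
      `|mdist x x' - mdist y y'| < 2 * s].
Proof.
move=> /ereal_inf_lt[_ [r [Z [X' [Y' [[f fi <-] [g gi <-] hr]]]] <-]] rs.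
have /ereal_inf_lt[_ [t [t0 XY YX] <-]] := le_lt_trans hr rs.
rewrite lte_fin => ts.
exists (fun x y => mdist (f x) (g y) < t); split.
- move=> x; have [|_ [y _ <-]] := XY (f x); first by exists x.
  by rewrite ballEmdist/= metric_sym => h; exists y.
- move=> y; have [|_ [x _ <-]] := YX (g y); first by exists y.
  by rewrite ballEmdist/= => h; exists x.
- move=> x x' y y' xy xy'.
  have h1 := metric_triangle (f x) (g y) (f x').
  have h2 := metric_triangle (g y) (g y') (f x').
  have h3 := metric_triangle (g y) (f x) (g y').
  have h4 := metric_triangle (f x) (f x') (g y').
  rewrite -fi -gi ltr_norml.
  move: h1 h2 h3 h4 xy xy'.
  rewrite [mdist (g y') (f x')]metric_sym [mdist (g y) (f x)]metric_sym.
  by move=> *; apply/andP; split; lra.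
Qed.

End gromov_hausdorff.

Lemma mdist_simplex (R : realType) (lam : R) (lam_gt0 : 0 < lam) m
    (y y' : simplex lam_gt0 m) :
  mdist y y' = if y == y' then 0 else lam.
Proof. by []. Qed.

(** * Distance to a simplex in terms of partitions of [X] *)

Section gh_dist_simplex.
Context {R : realType} {X : finMetricType R} {lam : R} (lam_gt0 : 0 < lam).
Hypothesis diam_le : forall x x' : X, 2 * mdist x x' <= lam.

(* [alpha] bounds the distances between the classes of the partition defined by
   [p]; the two values of the cross distance average to [lam / 2]. *)
Lemma partition_coupling m (p : X -> simplex lam_gt0 m) (alpha : R) :
  0 <= alpha -> 2 * alpha <= lam ->
  (forall x x', p x != p x' -> alpha <= mdist x x') ->
  exists c : coupling X (simplex lam_gt0 m), forall x y,
    c x y = if p x == y then (lam - alpha) / 2 else (lam + alpha) / 2.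
Proof.
move=> alpha0 alphalt psep.
pose c x y := if p x == y then (lam - alpha) / 2 else (lam + alpha) / 2.
have c_ge x y : (lam - alpha) / 2 <= c x y.
  by rewrite /c; case: ifP => _; lra.
have c_le x y : c x y <= (lam + alpha) / 2.
  by rewrite /c; case: ifP => _; lra.
unshelve eexists (@Coupling _ _ _ c _ _ _ _ _).
- by move=> x y; apply: lt_le_trans (c_ge x y); move: lam_gt0 => *; lra.
- move=> x x' y; rewrite /c.
  have := psep x x'; have := mdist_ge0 x x'.
  case: (eqVneq (p x) y) => [<-|xy]; case: (eqVneq (p x') _) => [e|x'y] //.
  + by move=> *; lra.
  + by move=> *; lra.
  (* Only here does the cross distance exceed its value at [x'], by [alpha]; the separation of the
     classes pays for it. *)
  + by rewrite e xy => _ /(_ isT) ?; lra.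
  + by move=> *; lra.
- move=> x y y'; rewrite mdist_simplex.
  case: (eqVneq y' y) => [->|_]; first by rewrite addr0.
  by have := c_ge x y'; have := c_le x y; move: lam_gt0 => *; lra.
(* Two cross distances sum to at least [lam - alpha >= lam / 2 >= mdist x x']. *)
- move=> x x' y; rewrite /c.
  have := mdist_ge0 x x'; have := diam_le x x'.
  by case: eqP => _; case: eqP => _ *; lra.
- move=> x y y'; rewrite mdist_simplex.
  have := c_ge x y; have := c_ge x y'; rewrite /c.
  case: (eqVneq y y') => [->|yy']; first by move=> *; lra.
  (* At most one of [y] and [y'] is [p x], so the two cross distances sum to at least [lam]. *)
  case: (eqVneq (p x) y) => [->|xy]; case: (eqVneq _ y') => [e|x'y] *; try lra.
  by rewrite e eqxx in yy'.
- by [].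
Qed.

Lemma gh_dist_simplex_ub m (p : X -> simplex lam_gt0 m) (alpha : R) :
  (forall y, exists x, p x = y) -> 0 <= alpha -> 2 * alpha <= lam ->
  (forall x x', p x != p x' -> alpha <= mdist x x') ->
  (gh_dist X (simplex lam_gt0 m) <= ((lam - alpha) / 2)%:E)%E.
Proof.
move=> psurj alpha0 alphalt psep.
have [c cE] := partition_coupling alpha0 alphalt psep.
apply: (gh_dist_le_coupling (c := c)); first by move: lam_gt0 => *; lra.
- by move=> x; exists (p x); rewrite cE eqxx.
- by move=> y; have [x px] := psurj y; exists x; rewrite cE px eqxx.
Qed.

(** For [alpha = 0] all cross distances equal [lam / 2], so the partition into a single class
    suffices. *)
Lemma gh_dist_simplex_ub_half m : (0 < #|X|)%N ->
  (gh_dist X (simplex lam_gt0 m.+1) <= (lam / 2)%:E)%E.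
Proof.
move=> /card_gt0P[x0 _]; pose y0 : simplex lam_gt0 m.+1 := ord0.
have [||x x' _|c cE] := @partition_coupling _ (fun=> y0) 0 => //.
- by rewrite mulr0 ltW.
- exact: mdist_ge0.
have {}cE x y : c x y <= lam / 2.
  by rewrite cE; case: ifP => _; rewrite ?subr0 ?addr0.
apply: (gh_dist_le_coupling (c := c)); [|by exists y0|by exists x0].
by rewrite divr_ge0 ?ltW.
Qed.

(** At a smaller distance there is a correspondence of distortion below [lam - alpha]; points
    related to distinct vertices are then more than [alpha] apart, and choosing a related vertex for
    each point contradicts [cut]. *)
Lemma gh_dist_simplex_lb m (alpha : R) : 0 <= alpha ->
  (forall p : X -> 'I_m, (forall y, exists x, p x = y) ->
    exists x x', p x != p x' /\ mdist x x' <= alpha) ->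
  (((lam - alpha) / 2)%:E <= gh_dist X (simplex lam_gt0 m))%E.
Proof.
move=> alpha0 cut; rewrite leNgt; apply/negP => /gh_dist_lt_correspondence.
move=> [C [CX CY Cdist]].
have far x x' y y' : y != y' -> C x y -> C x' y' -> alpha < mdist x x'.
  move=> yy' xy xy'; have := Cdist _ _ _ _ xy xy'.
  by rewrite mdist_simplex (negbTE yy') ltr_norml => /andP[]; lra.
have [p Cp] := choice CX.
have [y|x [x' [pxx' dxx']]] := cut p.
  (* A point related to two distinct vertices would be more than [alpha] away from itself. *)
  have [x Cxy] := CY y; exists x; apply/eqP/negPn/negP => pxy.
  by have := far _ _ _ _ pxy (Cp x) Cxy; rewrite mdistxx ltNge alpha0.
by have := far _ _ _ _ pxx' (Cp x) (Cp x'); rewrite ltNge dxx'.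
Qed.

End gh_dist_simplex.

(** * Crossing edges and acyclicity in finite graphs *)

Section graph.
Context {T : finType}.
Implicit Type e : rel T.

(* A set of classes grows one class at a time, always along a crossing edge. *)
Lemma connected_crossings e (C : finType) (p : T -> C) :
  symmetric e -> (forall x y, connect e x y) ->
  ((#|codom p|.-1).*2 <=
    #|[pred xy : T * T | e xy.1 xy.2 && (p xy.1 != p xy.2)]|)%N.
Proof.
move=> esym econ.
pose inner (S : {set C}) := [set xy : T * T |
  [&& e xy.1 xy.2, p xy.1 != p xy.2, p xy.1 \in S & p xy.2 \in S]]%SET.
case: (posnP #|codom p|) => [->//|codom_gt0].
suff grow j : (j < #|codom p|)%N -> exists S : {set C},
    [/\ #|S| = j.+1, S \subset codom p & (j.*2 <= #|inner S|)%N].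
  have [|S [_ _ le_inner]] := grow #|codom p|.-1; first by rewrite prednK.
  apply: leq_trans le_inner _.
  apply: subset_leq_card; apply/fintype.subsetP => xy.
  by rewrite !inE => /and4P[-> ->].
elim: j => [_|j IHj lt_j].
  have [c cp] := card_gt0P codom_gt0.
  exists [set c]%SET; rewrite cards1; split => //.
  by apply/fintype.subsetP => c'; rewrite inE => /eqP->.
have [S [cardS subS leS]] := IHj (ltnW lt_j).
have [c cp cS] : exists2 c, c \in codom p & c \notin S.
  apply/exists_inP; rewrite -negb_forall_in.
  apply: contraL lt_j => /forall_inP h.
  rewrite -leqNgt -cardS; apply: subset_leq_card; apply/fintype.subsetP.
  exact: h.
have [x cE] := codomP cp; subst c.
have [s sS] : exists s, s \in S by apply/card_gt0P; rewrite cardS.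
have [y sE] := codomP (fintype.subsetP subS _ sS); subst s.
(* Otherwise the preimage of [S] would be closed under [e], yet it contains [y] and not [x]. *)
have [u [v [euv uS vS]]] : exists u v, [/\ e u v, p u \in S & p v \notin S].
  apply/not_existsP => no_edge.
  suff cl : fingraph.closed e [pred z | p z \in S].
    by have := closed_connect cl (econ x y); rewrite !inE sS (negbTE cS).
  apply: intro_closed => [|z z' ezz' zS]; first exact: sym_connect_sym.
  rewrite inE; apply/negPn/negP => z'S; apply: (no_edge z).
  by exists z'.
exists (p v |: S)%SET; split.
- by rewrite cardsU1 vS cardS.
- apply/fintype.subsetP => c; rewrite !inE.
  move=> /orP[/eqP->|]; first exact: codom_f.
  exact: (fintype.subsetP subS).
(* The edge counts in both orientations; neither pair lies in [inner S], so the count grows by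
   two. *)
- have pvu : p v != p u by apply: contra vS => /eqP ->.
  have uv : (u, v) \notin inner S by rewrite inE /= (negbTE vS) !andbF.
  have vu : (v, u) \notin ((u, v) |: inner S)%SET.
    rewrite !inE /= (negbTE vS) !andbF orbF xpair_eqE negb_and.
    by apply/orP; left; apply: contra pvu => /eqP ->.
  have := cardsU1 (v, u) ((u, v) |: inner S)%SET.
  rewrite vu (cardsU1 (u, v)) uv !add1n doubleS => cardE.
  rewrite (leq_trans (n := (#|inner S|).+2)) ?ltnS // -cardE.
  apply: subset_leq_card; apply/fintype.subsetP => -[z z'].
  rewrite !inE /= !xpair_eqE.
  case/or3P => [/andP[/eqP-> /eqP->]|/andP[/eqP-> /eqP->]|/and4P[-> -> -> ->]].
  + by rewrite esym euv pvu uS eqxx orbT.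
  + by rewrite euv eq_sym pvu uS eqxx orbT.
  + by rewrite !orbT.
Qed.

Lemma card_codom_gt1 (C : finType) (p : T -> C) :
  (1 < #|codom p|)%N -> exists x y, p x != p y.
Proof.
by case/card_gt1P => _ [_ [/codomP[x ->] /codomP[y ->] xy]]; exists x, y.
Qed.

Definition joins (a b x y : T) := ((x, y) == (a, b)) || ((y, x) == (a, b)).

(** In a cycle started at [a], only the first and last edges can be new. They lead to distinct
    vertices, so at most one is new, and dropping it leaves an [e]-path between [a] and [b]. *)
Lemma acyclic_add_edge e (a b : T) :
  symmetric e -> ~~ connect e a b ->
  (forall p : seq T, ucycle e p -> (size p <= 2)%N) ->
  forall p : seq T, ucycle (fun x y => e x y || joins a b x y) p ->
    (size p <= 2)%N.
Proof.
move=> esym nab acyc p /andP[]; set e' := (fun x y => _).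
have e'E x y : x != a -> y != a -> e' x y = e x y.
  by move=> /negbTE xa /negbTE ya; rewrite /e' /joins !xpair_eqE xa ya orbF.
have [ap|ap] := boolP (a \in p); last first.
  move=> cp up; apply: acyc; rewrite /ucycle up andbT.
  apply: (sub_in_cycle (P := predC1 a) (e := e')) cp.
    by move=> x y xa ya; rewrite e'E.
  by apply/allP => x xp /=; apply: contraNneq ap => <-.
have [i q rotE] := rot_to ap.
rewrite -(rot_cycle i) -(rot_uniq i) -(size_rot i) {}rotE.
case: q => [//|y q]; rewrite leqNgt /= rcons_path => /and3P[ay].
move=> pyq zy /andP[ayq yq]; apply/negP => szq.
have {}pyq : path e y q.
  rewrite (eq_in_path (P := predC1 a) (e' := e')) // => [z z' za za'|].
    by rewrite e'E.
  by apply/allP => z zq /=; apply: contraNneq ayq => <-.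
have yz : last y q != y.
  move: yq; case: q szq {pyq zy ayq} => // z q _.
  rewrite cons_uniq => /andP[+ _]; apply: contraNneq => /= lastE.
  by rewrite -lastE mem_last.
have za : last y q != a by apply: contraNneq ayq => <-; exact: mem_last.
have ya : y != a by apply: contraNneq ayq => ->; exact: mem_head.
have cyz : connect e y (last y q) by apply/connectP; exists q.
move: ay zy; rewrite /e' /joins !xpair_eqE eqxx (negbTE za) (negbTE ya) /=.
rewrite ?andbF ?orbF ?andbT.
case/orP => [eay|/eqP yb]; case/orP => [eza|/eqP zb].
- suff : (size (a :: y :: q) <= 2)%N by rewrite leqNgt /= szq.
  by apply: acyc; rewrite /ucycle /= rcons_path eay pyq eza ayq yq.
- by move: nab; rewrite -zb (connect_trans (connect1 eay) cyz).
- move: nab; rewrite -yb sym_connect_sym //.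
  by rewrite (connect_trans cyz (connect1 eza)).
- by move: yz; rewrite zb yb eqxx.
Qed.

End graph.

(** * Kruskal classes, edges and weights *)

Section kruskal.
Context {R : realType} {X : finMetricType R}.
Variable x0 : X.

(* The default [(x0, x0)] is returned only for a constant [p]. *)
Definition bridge (p : X -> X) : X * X :=
  odflt (x0, x0) [pick ab | (p ab.1 != p ab.2) &&
    [forall cd : X * X, (p cd.1 != p cd.2) ==>
      (mdist ab.1 ab.2 <= mdist cd.1 cd.2)]].

(* [kruskal_class i x] represents the component of [x] after [i] steps. *)
Fixpoint kruskal_class (i : nat) : X -> X :=
  if i is i'.+1 then
    let ab := bridge (kruskal_class i') in
    fun x => if kruskal_class i' x == kruskal_class i' ab.2
             then kruskal_class i' ab.1 else kruskal_class i' x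
  else id.

Definition kruskal_edge (i : nat) : X * X := bridge (kruskal_class i).

Definition kruskal_weight (i : nat) : R :=
  mdist (kruskal_edge i).1 (kruskal_edge i).2.

Definition kruskal_graph (i : nat) : rel X := fun x y =>
  [exists j : 'I_i, joins (kruskal_edge j).1 (kruskal_edge j).2 x y].

Lemma bridgeP p x y : p x != p y ->
  p (bridge p).1 != p (bridge p).2 /\
  mdist (bridge p).1 (bridge p).2 <= mdist x y.
Proof.
move=> pxy; rewrite /bridge; case: pickP => [ab /andP[pab /forallP min]|none].
  by split=> //=; exact: (implyP (min (x, y)) pxy).
pose P := [pred ab : X * X | p ab.1 != p ab.2].
pose f (ab : X * X) : R := mdist ab.1 ab.2.
have Pxy : P (x, y) by [].
case: (arg_minP f Pxy) => ab Pab min.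
have /negP[] := none ab; rewrite [_ != _]Pab /=.
by apply/forallP => cd; apply/implyP => /min.
Qed.

(** A merge removes exactly one representative, that of the second endpoint. *)
Lemma card_kruskal_class i :
  (i < #|X|)%N -> #|codom (kruskal_class i)| = (#|X| - i)%N.
Proof.
elim: i => [_|i IHi lt_i].
  by rewrite subn0; apply: eq_card => x; rewrite (codom_f (kruskal_class 0) x).
have {IHi}cardE := IHi (ltnW lt_i).
have [x [y]] : exists x y, kruskal_class i x != kruskal_class i y.
  by apply: card_codom_gt1; rewrite cardE ltn_subRL addn1.
case/bridgeP; rewrite -/(kruskal_edge i); set ab := kruskal_edge i => neq_ab _.
rewrite subnS -cardE [in RHS](cardD1 (kruskal_class i ab.2)) codom_f add1n /=.
apply/eq_card => c; rewrite !inE.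
apply/codomP/andP => [[z ->] /=|[cb /codomP[z cz]]].
  rewrite -/(kruskal_edge i) -/ab.
  by case: ifPn => zb; rewrite codom_f.
exists z; rewrite /= -/(kruskal_edge i) -/ab -cz; case: eqP => // cE.
by rewrite cE eqxx in cb.
Qed.

Lemma kruskal_edge_separated i : (i.+1 < #|X|)%N ->
  kruskal_class i (kruskal_edge i).1 != kruskal_class i (kruskal_edge i).2.
Proof.
move=> lt_i; have : (1 < #|codom (kruskal_class i)|)%N.
  by rewrite (card_kruskal_class (ltnW lt_i)) ltn_subRL addn1.
by move=> /card_codom_gt1[x [y /bridgeP[]]].
Qed.

Lemma kruskal_weight_le i x y : kruskal_class i x != kruskal_class i y ->
  kruskal_weight i <= mdist x y.
Proof. by case/bridgeP. Qed.

Lemma kruskal_class_coarser i j x y : (i <= j)%N ->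
  kruskal_class i x = kruskal_class i y ->
  kruskal_class j x = kruskal_class j y.
Proof.
move=> /subnK <-; elim: (j - i)%N => // k IHk xy.
by rewrite addSn /= (IHk xy).
Qed.

Lemma kruskal_class_edge i j : (j < i)%N ->
  kruskal_class i (kruskal_edge j).1 = kruskal_class i (kruskal_edge j).2.
Proof.
move=> ji; apply: (kruskal_class_coarser ji).
by rewrite /= -/(kruskal_edge j) eqxx; case: ifP.
Qed.

(** The edge of step [j] also joins distinct classes of the finer step [i], where the chosen edge is
    shortest. *)
Lemma kruskal_weight_homo i j : (i <= j)%N -> (j.+1 < #|X|)%N ->
  kruskal_weight i <= kruskal_weight j.
Proof.
move=> ij /kruskal_edge_separated nab; apply: kruskal_weight_le.
by apply: contra nab => /eqP /(kruskal_class_coarser ij) ->.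
Qed.

(** The first [i] edges generate the classes of step [i]; this serves both for partitions and for
    connectivity. *)
Lemma constant_on_kruskal_classes i (C : Type) (p : X -> C) :
  (forall j, (j < i)%N -> p (kruskal_edge j).1 = p (kruskal_edge j).2) ->
  forall x y, kruskal_class i x = kruskal_class i y -> p x = p y.
Proof.
elim: i => [_ x y /= ->//|i IHi pedge x y /=].
have {}IHi := IHi (fun j ji => pedge j (ltnW ji)).
have := pedge i (ltnSn i); rewrite -/(kruskal_edge i).
set ab := kruskal_edge i => pab.
case: eqP => [/IHi ->|_]; case: eqP => [/IHi ->|_] //.
- by move=> /IHi <-.
- by move=> /IHi ->.
- exact: IHi.
Qed.

(** Otherwise [p] factors through the classes of step [i] and takes at most [#|X| - i] values. *)
Lemma kruskal_crosses_partition i (C : finType) (p : X -> C) :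
  (i < #|X|)%N -> (#|X| - i < #|codom p|)%N ->
  exists2 j, (j < i)%N & p (kruskal_edge j).1 != p (kruskal_edge j).2.
Proof.
move=> lt_i; rewrite -card_kruskal_class //; apply: contraPP => none.
apply/negP; rewrite -leqNgt.
have {}none j : (j < i)%N -> p (kruskal_edge j).1 = p (kruskal_edge j).2.
  by move=> ji; apply/eqP/negPn/negP => nab; apply: none; exists j.
have pcl := constant_on_kruskal_classes none.
pose lift c := odflt x0 [pick x | kruskal_class i x == c].
apply: leq_trans (leq_image_card (p \o lift) (mem (codom (kruskal_class i)))).
apply: subset_leq_card; apply/fintype.subsetP => _ /codomP[x ->].
have -> : p x = (p \o lift) (kruskal_class i x).
  rewrite /= /lift; case: pickP => [y /eqP /pcl -> //|/(_ x)].
  by rewrite eqxx.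
by apply: fintype.image_f; exact: codom_f.
Qed.

(** * The Kruskal graph as a minimum spanning tree *)

Lemma kruskal_graph_sym i : symmetric (kruskal_graph i).
Proof.
by move=> x y; apply: eq_existsb => j; rewrite /joins orbC.
Qed.

Lemma kruskal_graph_same_class i x y : kruskal_graph i x y ->
  kruskal_class i x = kruskal_class i y.
Proof.
case/existsP => j; rewrite /joins.
have := kruskal_class_edge (ltn_ord j); case: (kruskal_edge j) => a b /= ab.
by case/orP => /eqP[-> ->].
Qed.

Lemma connect_kruskal_graph i x y :
  connect (kruskal_graph i) x y = (kruskal_class i x == kruskal_class i y).
Proof.
have csym := sym_connect_sym (@kruskal_graph_sym i).
apply/idP/eqP => [|xy].
  have cl : fingraph.closed (kruskal_graph i)
      [pred z | kruskal_class i z == kruskal_class i x].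
    by move=> z z' /kruskal_graph_same_class zz'; rewrite !inE zz'.
  by move=> /(closed_connect cl); rewrite !inE eqxx => /esym/eqP.
(* Connectedness is equality of roots, so the root map takes the place of [p]. *)
apply/(fingraph.rootP csym); apply: constant_on_kruskal_classes xy => j ji.
apply/(fingraph.rootP csym)/connect1/existsP; exists (Ordinal ji).
by rewrite /joins /= -surjective_pairing eqxx.
Qed.

Lemma kruskal_graphS i x y : kruskal_graph i.+1 x y =
  kruskal_graph i x y || joins (kruskal_edge i).1 (kruskal_edge i).2 x y.
Proof.
apply/existsP/orP => [[j]|[/existsP[j jxy]|ixy]].
- case: (unliftP ord_max j) => [k ->|->]; last by right.
  by rewrite /= /bump leqNgt ltn_ord => kxy; left; apply/existsP; exists k.
- by exists (widen_ord (leqnSn i) j).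
- by exists ord_max.
Qed.

Lemma kruskal_graph_acyclic i : (i < #|X|)%N ->
  forall p : seq X, ucycle (kruskal_graph i) p -> (size p <= 2)%N.
Proof.
elim: i => [_ [//|x [//|y s]]|i IHi lt_i p].
  by rewrite /ucycle /= => /andP[/andP[/existsP[[]]]].
move=> cp; apply: (acyclic_add_edge (e := kruskal_graph i)
  (a := (kruskal_edge i).1) (b := (kruskal_edge i).2)).
- exact: kruskal_graph_sym.
- by rewrite connect_kruskal_graph kruskal_edge_separated.
- exact: IHi (ltnW lt_i).
- rewrite /ucycle; case/andP: cp => cp ->; rewrite andbT.
  by rewrite -(eq_cycle (kruskal_graphS i)).
Qed.

Lemma kruskal_graph_is_tree : is_tree (kruskal_graph #|X|.-1).
Proof.
have X_gt0 : (0 < #|X|)%N by apply/card_gt0P; exists x0.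
have lt_X : (#|X|.-1 < #|X|)%N by rewrite prednK.
split.
- exact: kruskal_graph_sym.
- move=> x; apply/existsP => -[j].
  have /kruskal_edge_separated : (j.+1 < #|X|)%N.
    by rewrite (leq_trans _ lt_X) // ltnS.
  case: (kruskal_edge j) => a b /= nab; rewrite /joins orbb => /eqP[xa xb].
  by rewrite -xa -xb eqxx in nab.
- move=> x y; rewrite connect_kruskal_graph.
  have : (#|codom (kruskal_class #|X|.-1)| <= 1)%N.
    by rewrite card_kruskal_class // leq_subLR addn1 prednK.
  by move/card_le1_eqP => /(_ _ _ (codom_f _ x) (codom_f _ y)) ->.
- exact: kruskal_graph_acyclic.
Qed.

(** An upper bound is enough for [mst]: each step adds at most the two orientations of one edge,
    whether or not they are new. *)
Lemma tree_length_kruskal_graph i :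
  tree_length (kruskal_graph i) <= \sum_(0 <= j < i) kruskal_weight j.
Proof.
rewrite /tree_length ler_pdivrMr ?ltr0n //.
rewrite (pair_big_dep _ (fun x y => kruskal_graph i x y)) /=.
elim: i => [|i IHi].
  by rewrite big_pred0 ?big_geq ?mul0r // => xy; apply/existsP => -[[]].
have splitU (P Q : pred (X * X)) :
    \sum_(xy | P xy || Q xy) mdist xy.1 xy.2 <=
    \sum_(xy | P xy) mdist xy.1 xy.2 + \sum_(xy | Q xy) mdist xy.1 xy.2 :> R.
  rewrite big_mkcond [X in _ <= X + _]big_mkcond [X in _ <= _ + X]big_mkcond /=.
  rewrite -big_split /=; apply: ler_sum => xy _; have m0 := mdist_ge0 xy.1 xy.2.
  by case: (P xy); case: (Q xy); rewrite /= ?addr0 ?add0r ?lerDl.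
rewrite big_nat_recr //= mulrDl.
under eq_bigl do rewrite kruskal_graphS.
apply: le_trans (splitU _ _) _; apply: lerD => //.
apply: le_trans (splitU _ _) _; rewrite mulr_natr mulr2n; apply: lerD.
  by rewrite (big_pred1 (kruskal_edge i)) // => -[x y]; case: (kruskal_edge i).
rewrite (big_pred1 ((kruskal_edge i).2, (kruskal_edge i).1)) /=.
  by rewrite metric_sym.
by move=> [x y] /=; rewrite !xpair_eqE andbC.
Qed.

(* Abel summation: the pairs joining distinct classes of step [j] number at
   least [2 * (#|X| - 1 - j)], and their lengths are at least
   [kruskal_weight j]. *)
Lemma kruskal_weight_le_crossings (e : rel X) (k j : nat) (t : R) :
  symmetric e -> (forall x y, connect e x y) -> (j + k).+1 = #|X| ->
  (forall x y, kruskal_class j x != kruskal_class j y -> t <= mdist x y) ->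
  (\sum_(j <= i < j + k) (kruskal_weight i - t)) * 2 <=
  \sum_(xy : X * X |
      e xy.1 xy.2 && (kruskal_class j xy.1 != kruskal_class j xy.2))
    (mdist xy.1 xy.2 - t).
Proof.
move=> esym econ; elim: k j t => [|k IHk] j t jk tle.
  rewrite addn0 big_geq // mul0r; apply: sumr_ge0 => xy /andP[_ /tle].
  by rewrite subr_ge0.
rewrite addnS in jk *.
have lt_j : (j.+1 < #|X|)%N by rewrite -jk !ltnS leq_addr.
(* The next step is taken with the threshold raised from [t] to the weight of step [j]. *)
have := IHk j.+1 (kruskal_weight j); rewrite addSn => /(_ jk) IH.
have {IH} := IH (fun x y nxy => kruskal_weight_le
  (contra_neq (@kruskal_class_coarser _ _ _ _ (leqnSn j)) nxy)).
move=> IH; rewrite big_ltn ?ltnS ?leq_addr //.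
set w := kruskal_weight j in IH *.
have wt : 0 <= w - t by rewrite subr_ge0 tle // kruskal_edge_separated.
pose P := [pred xy : X * X |
  e xy.1 xy.2 && (kruskal_class j xy.1 != kruskal_class j xy.2)].
(* Raising the threshold to [w] splits off [w - t] from each of the [#|P|] pairs; on the left it
   comes off [k.+1] weights, and [connected_crossings] gives [#|P| >= 2 * k.+1]. *)
have -> : \sum_(xy | P xy) (mdist xy.1 xy.2 - t) =
    \sum_(xy | P xy) (mdist xy.1 xy.2 - w) + (w - t) *+ #|P|.
  rewrite -sumr_const -big_split /=; apply: eq_bigr => xy _.
  by rewrite addrA subrK.
have -> : \sum_(j.+1 <= i < (j + k).+1) (kruskal_weight i - t) =
    \sum_(j.+1 <= i < (j + k).+1) (kruskal_weight i - w) + (w - t) *+ k.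
  rewrite -[k in _ *+ k](_ : ((j + k).+1 - j.+1)%N = k); last first.
    by rewrite subSS addKn.
  rewrite -sumr_const_nat -big_split /=; apply: eq_bigr => i _.
  by rewrite addrA subrK.
rewrite addrCA -mulrS mulrDl; apply: lerD.
  (* Pairs separated at step [j] but no longer at [j.+1] contribute nonnegative terms. *)
  apply: le_trans IH _.
  rewrite big_mkcond [leRHS]big_mkcond /=; apply: ler_sum => -[x y] _ /=.
  have [] := boolP (e x y) => //= _.
  have [xy|xy] := eqVneq (kruskal_class j x) (kruskal_class j y).
    by rewrite xy eqxx.
  have wxy := kruskal_weight_le xy.
  by case: ifP => // _; rewrite subr_ge0.
have := connected_crossings (kruskal_class j) esym econ.
rewrite card_kruskal_class ?(ltnW lt_j) // -jk -!addnS addKn /= => cardP.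
by rewrite mulr_natr -mulrnA muln2 ler_wpMn2l.
Qed.

Lemma kruskal_le_tree_length (e : rel X) :
  symmetric e -> (forall x y, connect e x y) ->
  \sum_(0 <= i < #|X|.-1) kruskal_weight i <= tree_length e.
Proof.
move=> esym econ; rewrite /tree_length ler_pdivlMr ?ltr0n //.
have X_gt0 : (0 < #|X|)%N by apply/card_gt0P; exists x0.
have jk : (0 + #|X|.-1).+1 = #|X| by rewrite prednK.
have := kruskal_weight_le_crossings esym econ jk (fun x y _ => mdist_ge0 x y).
rewrite add0n; under eq_bigr do rewrite subr0.
move=> /le_trans; apply.
rewrite (pair_big_dep _ (fun x y => e x y)) /=.
rewrite big_mkcond [leRHS]big_mkcond /=; apply: ler_sum => -[x y] _ /=.
rewrite subr0; case: (e x y) => //=; case: ifP => // _; exact: mdist_ge0.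
Qed.

Lemma mst_kruskal : mst X = (\sum_(0 <= i < #|X|.-1) kruskal_weight i)%:E.
Proof.
apply/eqP; rewrite eq_le; apply/andP; split.
  apply: le_trans (_ : (tree_length (kruskal_graph #|X|.-1))%:E <= _)%E.
    apply: ereal_inf_lbound; exists (kruskal_graph #|X|.-1) => //.
    exact: kruskal_graph_is_tree.
  by rewrite lee_fin tree_length_kruskal_graph.
apply: le_ereal_inf_tmp => _ [e [esym _ econ _] <-].
by rewrite lee_fin kruskal_le_tree_length.
Qed.

End kruskal.

(** * Distances to simplices as Kruskal weights *)

Section gh_dist_kruskal.
Context {R : realType} {X : finMetricType R} {lam : R} (lam_gt0 : 0 < lam).
Hypothesis diam_le : forall x x' : X, 2 * mdist x x' <= lam.
Variable x0 : X.

Lemma exists_simplex_partition i m : (i < #|X|)%N -> m = (#|X| - i)%N ->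
  exists p : X -> simplex lam_gt0 m, (forall y, exists x, p x = y) /\
    (forall x x', p x != p x' -> kruskal_class x0 i x != kruskal_class x0 i x').
Proof.
move=> lt_i mE; have cardE : #|codom (kruskal_class x0 i)| = m.
  by rewrite card_kruskal_class.
pose rank x :=
  enum_rank_in (codom_f (kruskal_class x0 i) x0) (kruskal_class x0 i x).
exists (fun x => cast_ord cardE (rank x)); split => [y|x x'].
- have := enum_valP (cast_ord (esym cardE) y) => /codomP[x xE].
  exists x; apply: (canLR (cast_ordKV _)).
  by rewrite /rank -xE enum_valK_in.
- by apply: contraNneq => xx'; rewrite /rank xx'.
Qed.

Lemma gh_dist_simplex_kruskal k : (0 < k)%N -> (k < #|X|)%N ->
  gh_dist X (simplex lam_gt0 k.+1) =
  ((lam - kruskal_weight x0 (#|X| - k.+1)) / 2)%:E.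
Proof.
move=> k_gt0 lt_k; set i := (#|X| - k.+1)%N.
have iX : (i + k.+1)%N = #|X| by rewrite subnK.
have lt_i : (i.+1 < #|X|)%N.
  by rewrite -iX addnS ltnS -[X in (X < _)%N]addn0 ltn_add2l.
have w0 : 0 <= kruskal_weight x0 i by exact: mdist_ge0.
apply/eqP; rewrite eq_le; apply/andP; split.
(* Step [i] starts from [k.+1] classes, at mutual distances at least its weight. *)
- have [||p [psurj psep]] := @exists_simplex_partition i k.+1.
  + exact: ltnW.
  + by rewrite -iX addKn.
  + apply: (gh_dist_simplex_ub diam_le psurj w0 (diam_le _ _)) => x x'.
    by move=> /psep /kruskal_weight_le.
- apply: gh_dist_simplex_lb w0 _ => p psurj.
  have codomE : #|codom p| = k.+1.
    rewrite -[RHS]card_ord; apply: eq_card => y; rewrite inE.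
    by have [x <-] := psurj y; rewrite codom_f.
  (* The first [i.+1] edges leave only [k] classes, so one of them crosses [p], and its weight is at
     most that of step [i]. *)
  have [||j ji pj] := @kruskal_crosses_partition _ _ x0 i.+1 _ p => //.
    by rewrite codomE -iX addnS subSS addKn.
  exists (kruskal_edge x0 j).1, (kruskal_edge x0 j).2; split => //.
  exact: kruskal_weight_homo.
Qed.

(** No map from [X] onto [k.+1] points exists, so the lower bound holds vacuously with
    [alpha = 0]. *)
Lemma gh_dist_simplex_large k : (#|X| <= k)%N ->
  gh_dist X (simplex lam_gt0 k.+1) = (lam / 2)%:E.
Proof.
move=> le_k; apply/eqP; rewrite eq_le; apply/andP; split.
  by apply: gh_dist_simplex_ub_half => //; apply/card_gt0P; exists x0.
rewrite -[lam in leLHS]subr0; apply: gh_dist_simplex_lb => // p psurj.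
suff : (k.+1 <= #|X|)%N by rewrite ltnNge le_k.
rewrite -[k.+1]card_ord -(_ : #|codom p| = #|'I_k.+1|) ?leq_image_card //.
apply: eq_card => y; rewrite inE.
by have [x <-] := psurj y; rewrite codom_f.
Qed.

End gh_dist_kruskal.

(** * Summation over [k] *)

Local Open Scope ereal_scope.

Theorem corollary3p4 (R : realType) (X : finMetricType R)
    (X_gt0 : (0 < #|X|)%N) (lam : R) (lam_gt0 : (0 < lam)%R)
    (diam_le : 2%:E * diam X <= lam%:E) :
  ((fun n : nat =>
      \sum_(1 <= k < n.+1)
        (lam%:E - 2%:E * gh_dist X (simplex lam_gt0 k.+1))) @ \oo --> mst X)
  /\ mst X = (lam * (#|X|%:R - 1))%:E
             - 2%:E * \sum_(1 <= k < #|X|) gh_dist X (simplex lam_gt0 k.+1).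
Proof.
have diamX (x x' : X) : (2 * mdist x x' <= lam)%R.
  rewrite -lee_fin EFinM; apply: le_trans diam_le; apply: lee_wpmul2l => //.
  by apply: ereal_sup_ubound; exists (x, x').
have /card_gt0P[x0 _] := X_gt0.
pose w := kruskal_weight x0.
have sum_rev : (\sum_(0 <= i < #|X|.-1) w i =
    \sum_(1 <= k < #|X|) w (#|X| - k.+1)%N)%R.
  rewrite -{2}(prednK X_gt0) big_add1 /= big_nat_rev /= add0n.
  rewrite !big_mkord; apply: eq_bigr => i _; congr w.
  by case: #|X| X_gt0 i.
have termE k : (0 < k)%N ->
    lam%:E - 2%:E * gh_dist X (simplex lam_gt0 k.+1) =
    (if (k < #|X|)%N then w (#|X| - k.+1)%N else 0%R)%:E.
  move=> k_gt0; case: ltnP => kX.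
    rewrite (gh_dist_simplex_kruskal _ diamX x0) // -EFinM -EFinB.
    by congr EFin; rewrite -/w; lra.
  rewrite (gh_dist_simplex_large _ diamX x0) // -EFinM -EFinB.
  by congr EFin; lra.
have mstE : mst X = (\sum_(1 <= k < #|X|) w (#|X| - k.+1)%N)%:E.
  by rewrite (mst_kruskal x0) sum_rev.
split.
  (* The terms vanish from [k = #|X|] on, so the partial sums are eventually constant. *)
  apply: cvg_near_cst; exists #|X| => // n /= le_n.
  rewrite mstE (eq_big_nat _ _ (F2 := fun k =>
    (if (k < #|X|)%N then w (#|X| - k.+1)%N else 0%R)%:E)); last first.
    by move=> k /andP[k_gt0 _]; exact: termE.
  rewrite (big_cat_nat (n := #|X|)) //=; last exact: leqW.
  rewrite [X in _ + X](_ : _ = 0) ?adde0; last first.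
    rewrite big_nat; apply: big1 => k /andP[].
    by rewrite leqNgt => /negbTE ->.
  by rewrite sumEFin; congr EFin; apply: eq_big_nat => k /andP[_ ->].
rewrite mstE (eq_big_nat _ _ (F2 := fun k =>
  ((lam - w (#|X| - k.+1)%N) / 2)%:E)); last first.
  by move=> k /andP[k_gt0 kX]; exact: gh_dist_simplex_kruskal.
rewrite sumEFin -EFinM -EFinB; congr EFin.
rewrite -mulr_suml sumrB sumr_const_nat -[(lam *+ _)%R]mulr_natr natrB //.
lra.
Qed.
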